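(* Let $G\times M\to M$ be a left action of a Lie group with matrix of infinitesimals $\Phi$. If $H=H(z,\boldsymbol\xi)$ is a smooth function on $M\times\mathfrak g^*$ which is an invariant of the Lie group action $$(z,\boldsymbol\xi)\mapsto\left(g^{-1}\cdot z,\ \boldsymbol\xi\,\mathbf{Ad}(g)\right),$$ that is, $H(g^{-1}\cdot z,\boldsymbol\xi\,\mathbf{Ad}(g))=H(z,\boldsymbol\xi)$ for all $g\in G$, then for the Hamiltonian flow $$\begin{pmatrix}\dot z\\\dot{\boldsymbol\xi}\end{pmatrix}=\begin{pmatrix}0&\Phi\\-\Phi^T&\Lambda(\mathfrak g^* )\end{pmatrix}\begin{pmatrix}\nabla_zH\\\nabla_{\boldsymbol\xi}H\end{pmatrix}$$ one has $\dot{\boldsymbol\xi}\equiv0$.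
   Context: Let $G$ be a Lie group of dimension $r$, with Lie algebra $\mathfrak g=T_eG$ and bracket $[v,w]=\frac{d}{dt}|_{t=0}\mathrm{Ad}(\exp(tv))w$ (for matrix groups, $\mathrm{Ad}(g)v=gvg^{-1}$ and $[X,Y]=XY-YX$). A left action satisfies $h\cdot(g\cdot z)=(hg)\cdot z$. Everything is local: $M$ is an open subset of $\mathbb R^p$ with coordinates $z=(z^1,\dots,z^p)$. Fix a basis $v_1,\dots,v_r$ of $\mathfrak g$. The matrix of infinitesimals is the $p\times r$ matrix with $\Phi_{\ell k}(z)=\frac{d}{dt}|_{t=0}(\exp(tv_k)\cdot z)^\ell$. The coordinates on $\mathfrak g^*$ are $\xi_i(\theta)=\theta(v_i)$; $\boldsymbol\xi=(\xi_1,\dots,\xi_r)$ is written as a row vector when multiplied by $\mathbf{Ad}(g)$ on the right, and as a column in the Hamiltonian system. $\Lambda(\mathfrak g^* )$ is the matrix with entries $\sum_kc_{ij}^k\xi_k$, where $[v_i,v_j]=\sum_kc_{ij}^kv_k$. The matrix $\mathbf{Ad}(g)$ is defined by $\mathrm{Ad}(g)v_j=\sum_i\mathbf{Ad}(g)_{ij}v_i$. *)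

(* Defs.v *)
From HB Require Import structures.
From mathcomp Require Import all_boot all_order all_algebra.
From mathcomp Require Import all_classical all_reals all_analysis.

Set Implicit Arguments.
Unset Strict Implicit.
Unset Printing Implicit Defensive.

Import Order.TTheory GRing.Theory Num.Theory.
Import numFieldNormedType.Exports.

Local Open Scope classical_set_scope.
Local Open Scope ring_scope.

Section Smooth.
Context {R : realType} {E F : normedModType R}.

Fixpoint diffclass (k : nat) (U : set E) (f : E -> F) : Prop :=
  match k with
  | 0%N => forall x, U x -> {for x, continuous f}
  | k'.+1 => (forall x, U x -> differentiable f x) /\
             (forall v : E, diffclass k' U (fun x => 'D_v f x))
  end.

(* Meant for open U: only the germs of f at the points of U matter. *)
Definition smooth_on (U : set E) (f : E -> F) := forall k, diffclass k U f.

End Smooth.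

(* A homeomorphism from the open set cdom onto the open set cmap @` cdom of
   R^n, with inverse cinv; outside of these sets the two total functions cmap
   and cinv carry no information. *)
Record chart (R : realType) (n : nat) (T : topologicalType) := Chart {
  cdom : set T;
  cmap : T -> 'rV[R]_n;
  cinv : 'rV[R]_n -> T;
  cdom_open : open cdom;
  ccod_open : open (cmap @` cdom);
  cmapK : forall x, cdom x -> cinv (cmap x) = x;
  cmap_continuous : forall x, cdom x -> {for x, continuous cmap};
  cinv_continuous : forall y, (cmap @` cdom) y -> {for y, continuous cinv}
}.

Definition ccod (R : realType) n (T : topologicalType) (c : chart R n T) :
  set 'rV[R]_n := cmap c @` cdom c.

Definition smooth_compatible (R : realType) n (T : topologicalType)
    (c d : chart R n T) :=
  smooth_on (cmap c @` (cdom c `&` cdom d)) (cmap d \o cinv c).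

(* Besides the atlas, a manifold carries a preferred chart around each point,
   in which tangent vectors at that point are read: the tangent space at any
   point is 'rV[R]_n. *)
HB.mixin Record isManifold (R : realType) (n : nat) T of Topological T := {
  atlas : set (chart R n T);
  chart_at : T -> chart R n T;
  chart_at_atlas : forall x, atlas (chart_at x);
  chart_at_dom : forall x, cdom (chart_at x) x;
  atlas_compatible :
    forall c d, atlas c -> atlas d -> smooth_compatible c d;
  manifold_hausdorff : hausdorff_space T;
  manifold_second_countable : @second_countable T
}.

#[short(type="manifoldType")]
HB.structure Definition Manifold (R : realType) (n : nat) :=
  {T of isManifold R n T & Topological T}.

HB.mixin Record isLieGroup (R : realType) (n : nat) G
    of Group G & Manifold R n G := {
  lie_mul_continuous :
    continuous (fun xy : G * G => (xy.1 * xy.2)%g);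
  lie_inv_continuous : continuous (fun x : G => (x^-1)%g);
  lie_mul_smooth : forall a b c : chart R n G,
    atlas a -> atlas b -> atlas c ->
    smooth_on
      [set xy : 'rV[R]_n * 'rV[R]_n | [/\ ccod a xy.1, ccod b xy.2
                            & cdom c (cinv a xy.1 * cinv b xy.2)%g]]
      (fun xy => cmap c (cinv a xy.1 * cinv b xy.2)%g);
  lie_inv_smooth : forall a c : chart R n G, atlas a -> atlas c ->
    smooth_on [set x | ccod a x /\ cdom c ((cinv a x)^-1)%g]
              (fun x => cmap c ((cinv a x)^-1)%g)
}.

#[short(type="lieGroupType")]
HB.structure Definition LieGroup (R : realType) (n : nat) :=
  {G of isLieGroup R n G & Group G & Manifold R n G}.

(* The Lie algebra T_e G is 'rV[R]_r, through the chart chart_at 1. *)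
Section LieAlgebra.
Context {R : realType} {r : nat} {G : lieGroupType R r}.
Implicit Types (g : G) (v w : 'rV[R]_r).

Definition tangent_map (f : G -> G) (x : G) : 'rV[R]_r -> 'rV[R]_r :=
  fun v => 'D_v (cmap (chart_at (f x)) \o f \o cinv (chart_at x))
                (cmap (chart_at x) x).

Definition smooth_curve (gamma : R -> G) :=
  continuous gamma /\
  forall c : chart R r G, atlas c ->
    smooth_on ((gamma : R^o -> G) @^-1` cdom c) (cmap c \o gamma).

Definition velocity (gamma : R -> G) (t : R) : 'rV[R]_r :=
  derive1 (cmap (chart_at (gamma t)) \o gamma) t.

Definition one_parameter_subgroup (gamma : R -> G) :=
  smooth_curve gamma /\ forall s t, gamma (s + t) = (gamma s * gamma t)%g.

(* The value at time 1 of the one-parameter subgroup with initial velocity v.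
   That subgroup exists and is unique in every Lie group, so the default
   value 1 is never used. *)
Definition lie_exp v : G :=
  xget 1%g [set g | exists gamma,
    [/\ one_parameter_subgroup gamma, velocity gamma 0 = v & gamma 1 = g]].

Definition Ad g : 'rV[R]_r -> 'rV[R]_r :=
  tangent_map (fun h => g * h * g^-1)%g 1%g.

Definition bracket v w : 'rV[R]_r :=
  derive1 (fun t : R => Ad (lie_exp (t *: v)) w) 0.

End LieAlgebra.

(* Coordinates with respect to a basis v of T_e G. A linear form theta on T_e G
   is given by the row vector xi = (theta v_1, ..., theta v_r). *)
Section Coordinates.
Context {R : realType} {r : nat} (G : lieGroupType R r).
Variable v : r.-tuple 'rV[R]_r.

Definition Ad_mx (g : G) : 'M[R]_r := \matrix_(i, j) coord v i (Ad g v`_j).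

Definition structure_constant (i j k : 'I_r) : R :=
  coord v k (bracket (G := G) v`_i v`_j).

Definition Lambda (xi : 'rV[R]_r) : 'M[R]_r :=
  \matrix_(i, j) \sum_k structure_constant i j k * xi 0 k.

End Coordinates.

Section Action.
Context {R : realType} {r : nat} {G : lieGroupType R r} {p : nat}.

(* The values of act outside M are irrelevant. *)
Record smooth_left_action (M : set 'rV[R]_p) (act : G -> 'rV[R]_p -> 'rV[R]_p) :
    Prop := {
  act_closed : forall g z, M z -> M (act g z);
  act_one : forall z, M z -> act 1%g z = z;
  act_mul : forall h g z, M z -> act h (act g z) = act (h * g)%g z;
  act_smooth : forall c : chart R r G, atlas c ->
    smooth_on (ccod c `*` M)
      (fun xz : 'rV[R]_r * 'rV[R]_p => act (cinv c xz.1) xz.2)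
}.

Variables (v : r.-tuple 'rV[R]_r) (act : G -> 'rV[R]_p -> 'rV[R]_p).

Definition infinitesimals (z : 'rV[R]_p) : 'M[R]_(p, r) :=
  \matrix_(l, k) derive1 (fun t : R => act (lie_exp (t *: v`_k)) z 0 l) 0.

Variable H : 'rV[R]_p * 'rV[R]_r -> R.

Definition grad_z (z : 'rV[R]_p) (xi : 'rV[R]_r) : 'cV[R]_p :=
  \col_l 'D_(delta_mx 0 l) (fun y => H (y, xi)) z.

Definition grad_xi (z : 'rV[R]_p) (xi : 'rV[R]_r) : 'cV[R]_r :=
  \col_k 'D_(delta_mx 0 k) (fun eta => H (z, eta)) xi.

Definition hamiltonian_field (z : 'rV[R]_p) (xi : 'rV[R]_r) : 'cV[R]_(p + r) :=
  block_mx 0 (infinitesimals z) (- (infinitesimals z)^T) (Lambda G v xi)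
    *m col_mx (grad_z z xi) (grad_xi z xi).

Definition hamiltonian_flow_line (M : set 'rV[R]_p) (J : set R)
    (z : R -> 'rV[R]_p) (xi : R -> 'rV[R]_r) :=
  forall t, J t -> M (z t) /\
    is_derive t 1 (fun s => col_mx (z s)^T (xi s)^T)
      (hamiltonian_field (z t) (xi t)).

End Action.

(* Main.v *)
Require Import Defs.
From mathcomp Require Import all_boot all_order all_algebra.
From mathcomp Require Import all_classical all_reals all_analysis.

Set Implicit Arguments.
Unset Strict Implicit.
Unset Printing Implicit Defensive.

Import Order.TTheory GRing.Theory Num.Theory.
Import numFieldNormedType.Exports.

Local Open Scope classical_set_scope.
Local Open Scope ring_scope.

(** Differentiating the invariance of H along g = exp (t v_i) at t = 0 gives
    - (Phi^T grad_z H)_i + (Lambda grad_xi H)_i = 0, because the derivative of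
    Ad_mx (exp (t v_i)) has entries c_ij^k; this is the i-th component of xi'.
    The derivative makes sense once t |-> lie_exp (t *: v_i) is known to be a
    one-parameter subgroup. Existence of one-parameter subgroups is not needed
    for this, only uniqueness: if gamma1 and gamma2 have the same velocity at 0
    then gamma1 t * gamma2 (- t) has zero derivative at 0, hence, being
    gamma1 t * (gamma1 s * gamma2 (- s)) * gamma2 (- t) at time s + t, it has
    zero derivative at every t near 0, and is constant near 0. *)

(** * Directional derivatives and smoothness classes in normed modules *)

Section Calculus.
Context {R : realType}.

Lemma derive_comp (U V W : normedModType R) (f : V -> W) (g : U -> V) x v :
  differentiable g x -> differentiable f (g x) ->
  'D_v (f \o g) x = 'D_('D_v g x) f (g x).
Proof.
move=> dg df; rewrite !deriveE//; last exact: differentiable_comp.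
by rewrite diff_comp.
Qed.

Lemma is_derive_comp_curve (V W : normedModType R) (f : V -> W) (g : R -> V)
    (t : R) dg :
  is_derive t 1 g dg -> differentiable f (g t) ->
  is_derive t 1 (f \o g) ('D_dg f (g t)).
Proof.
move=> [/derivable1_diffP gt <-] df; split; last exact: derive_comp.
by apply/derivable1_diffP; exact: differentiable_comp.
Qed.

Lemma is_derive_pair (V W : normedModType R) (f : R -> V) (g : R -> W) (t : R)
    df dg :
  is_derive t 1 f df -> is_derive t 1 g dg ->
  is_derive t 1 (fun s => (f s, g s)) (df, dg).
Proof.
move=> [/derivable1_diffP ft <-] [/derivable1_diffP gt <-].
have fgt : differentiable (fun s => (f s, g s)) t by exact: differentiable_pair.
split; first exact/derivable1_diffP.
by rewrite !deriveE// diff_pair.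
Qed.

(** Both derivatives are limits of one and the same difference quotient. *)
Lemma is_derive_translate (V : normedModType R) (f : R -> V) (t : R) (df : V) :
  is_derive (0 : R) 1 (fun s => f (s + t)) df -> is_derive t 1 f df.
Proof.
have E : (fun h : R => h^-1 *: (((fun s => f (s + t)) \o shift 0) (h *: 1)
      - f (0 + t))) = (fun h : R => h^-1 *: ((f \o shift t) (h *: 1) - f t)).
  by apply/funext => h /=; rewrite addr0 add0r.
by move=> [+ <-]; rewrite /derivable /derive E.
Qed.

Lemma is_derive_scale_arg (V : normedModType R) (f : R -> V) (a : R) (df : V) :
  is_derive (0 : R) 1 f df ->
  is_derive (0 : R) 1 (fun t => f (a * t)) (a *: df).
Proof.
move=> [f0 fE].
have da : is_derive (0 : R) 1 (fun t : R => a * t) a.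
  by rewrite -[X in is_derive _ _ _ X]mulr1; exact: (@is_deriveZ _ _ R^o id).
have df0 : differentiable f (0 : R) by exact/derivable1_diffP.
have := @is_derive_comp_curve _ _ f _ _ _ da; rewrite mulr0 => /(_ df0).
suff -> : 'D_a f 0 = a *: df by [].
rewrite -fE !deriveE// -linearZ; congr ('d _ _ _).
by rewrite -[RHS]/(a * 1) mulr1.
Qed.

Lemma is_derive_opp_arg (V : normedModType R) (f : R -> V) (df : V) :
  is_derive (0 : R) 1 f df ->
  is_derive (0 : R) 1 (fun t => f (- t)) (- df).
Proof.
move=> /(is_derive_scale_arg (-1)); rewrite scaleN1r.
suff -> : (fun t => f (-1 * t)) = (fun t => f (- t)) by [].
by apply/funext => t; rewrite mulN1r.
Qed.

(** Adding [h *: (0, v)] leaves the first component at [a], so the two difference quotients are the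
    same function of [h]. *)
Lemma derive_paramr (U V W : normedModType R) (f : U * V -> W) a b v :
  'D_(0, v) f (a, b) = 'D_v (fun y => f (a, y)) b.
Proof.
rewrite /derive; set q := fun _ => _; set q' := fun _ => _.
suff -> : q = q' by []; apply/funext => h; rewrite /q /q' /=.
by rewrite -[_ *: _ + _]/(h *: 0 + a, h *: v + b) scaler0 add0r.
Qed.

Lemma derive_paraml (U V W : normedModType R) (f : U * V -> W) a b u :
  'D_(u, 0) f (a, b) = 'D_u (fun x => f (x, b)) a.
Proof.
rewrite /derive; set q := fun _ => _; set q' := fun _ => _.
suff -> : q = q' by []; apply/funext => h; rewrite /q /q' /=.
by rewrite -[_ *: _ + _]/(h *: u + a, h *: 0 + b) scaler0 add0r.
Qed.

Lemma differentiable_paramr (U V W : normedModType R) (f : U * V -> W) a b :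
  differentiable f (a, b) -> differentiable (fun y => f (a, y)) b.
Proof.
by move=> df; apply: (@differentiable_comp _ _ _ _ (fun y => (a, y)) f).
Qed.

Lemma differentiable_paraml (U V W : normedModType R) (f : U * V -> W) a b :
  differentiable f (a, b) -> differentiable (fun x => f (x, b)) a.
Proof.
by move=> df; apply: (@differentiable_comp _ _ _ _ (fun x => (x, b)) f).
Qed.

Lemma derive_pair_split (U V W : normedModType R) (f : U * V -> W) x u v :
  differentiable f x -> 'D_(u, v) f x = 'D_(u, 0) f x + 'D_(0, v) f x.
Proof.
move=> df; rewrite !deriveE// -linearD; congr ('d _ _ _).
by rewrite -[RHS]/(u + 0, 0 + v) addr0 add0r.
Qed.

Lemma derive_row n (W : normedModType R) (f : 'rV[R]_n -> W) a u :
  differentiable f a -> 'D_u f a = \sum_i u 0 i *: 'D_(delta_mx 0 i) f a.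
Proof.
move=> df; rewrite deriveE// [u in LHS]row_sum_delta linear_sum.
by apply: eq_bigr => i _; rewrite linearZ deriveE.
Qed.

Lemma is_derive_mxP m n (V : normedModType R) (f : V -> 'M[R]_(m, n)) x v df :
  is_derive x v f df <-> forall i j, is_derive x v (fun y => f y i j) (df i j).
Proof.
split=> [[dfx <-] i j|dfx].
  by split; [move/derivable_mxP : dfx; exact|rewrite derive_mx// mxE].
have fx : derivable f x v.
  by apply/derivable_mxP => i j; have [] := dfx i j.
split=> //; rewrite derive_mx//; apply/matrixP => i j; rewrite mxE.
by have [] := dfx i j.
Qed.

(** A linear form is a finite combination of the entries, which are differentiated one by one. It
    serves for the coordinate forms of a basis of the Lie algebra. *)
Lemma is_derive_linear_row n (V : normedModType R) (l : {scalar 'rV[R]_n})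
    (f : V -> 'rV[R]_n) x v df :
  is_derive x v f df -> is_derive x v (fun y => l (f y)) (l df).
Proof.
move=> /is_derive_mxP dfx.
have lE w : l w = \sum_i l (delta_mx 0 i) * w 0 i.
  rewrite [w in LHS]row_sum_delta linear_sum; apply: eq_bigr => i _.
  by rewrite linearZ mulrC.
rewrite lE (_ : (fun y => _) =
    \sum_i (l (delta_mx 0 i) \*: (fun y => f y 0 i : R^o))); last first.
  by apply/funext => y; rewrite lE fct_sumE.
apply: is_derive_sum => i; exact: is_deriveZ.
Qed.

(** Mean value theorem on the segment between [0] and [t], which stays in a ball where the
    derivative vanishes. *)
Lemma near0_derive0_cst (f : R -> R) :
  (\forall t \near (0 : R), is_derive (t : R) 1 f 0) ->
  \forall t \near (0 : R), f t = f 0.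
Proof.
move=> /nbhs_ballP[e /= e0 fe]; apply/nbhs_ballP; exists e => //= t te.
(* Ordering the endpoints lets one application of the theorem cover both signs of [t]. *)
pose a := Num.min 0 t; pose b := Num.max 0 t.
have ab : a <= b by rewrite /a /b; case: (ltP 0 t) => // /ltW.
have inball s : s \in `[a, b] -> ball 0 e s.
  move: te; rewrite -!ball_normE/= !sub0r !normrN => te.
  rewrite in_itv/= /a /b => /andP[]; case: (ltP 0 t) => t0 s0 st.
    by rewrite (le_lt_trans _ te)// !ger0_norm// ltW.
  by rewrite (le_lt_trans _ te)// !ler0_norm// lerN2.
have [||c _] := @MVT_segment R f (fun=> 0) a b ab.
- by move=> s /subset_itv_oo_cc /inball /fe.
- by apply: derivable_within_continuous => s /inball /fe[+ _].
by rewrite mul0r /a /b; case: (ltP 0 t) => _ /eqP; rewrite subr_eq0 => /eqP.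
Qed.

Lemma diffclass_cst k (E F : normedModType R) (U : set E) (a : F) :
  diffclass k U (fun=> a).
Proof.
elim: k a => [|k IHk] a; first by move=> x _; exact: cst_continuous.
split=> [x _|v]; first exact: differentiable_cst.
rewrite (_ : (fun x => 'D_v (fun=> a) x) = fun=> 0); first exact: IHk.
by apply/funext => x; exact: derive_cst.
Qed.

(** Induction on [k] for all [f] at once: the derivative of the rescaled function along [v] is the
    rescaled derivative of [f] along [a * v]. *)
Lemma diffclass_scale k (F : normedModType R) (U : set R^o) (f : R^o -> F)
    (a : R) :
  diffclass k U f -> diffclass k [set x | U (a * x)] (fun x => f (a * x)).
Proof.
have sd (x : R^o) : differentiable (fun y : R^o => a * y : R^o) x.
  exact: differentiableZ.
elim: k f => [|k IHk] f /=.
  move=> cf x /cf; apply: continuous_comp.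
  exact: differentiable_continuous.
move=> [df cf]; split=> [x /df|v].
  exact: differentiable_comp.
rewrite (_ : (fun x => 'D_v (fun y => f (a * y)) x) =
    fun x => 'D_(a * v) f (a * x)); last first.
  apply/funext => x; rewrite /derive; set q := fun _ => _; set q' := fun _ => _.
  suff -> : q = q' by []; apply/funext => h; rewrite /q /q' /=.
  by rewrite mulrDr -[h *: v]/(h * v) -[h *: (_ * _)]/(h * _) mulrCA.
exact: (IHk (fun y => 'D_(a * v) f y) (cf _)).
Qed.

End Calculus.

(** * The group law read in the chart at the identity *)

Section LieGroup.
Context {R : realType} {r : nat} {G : lieGroupType R r}.
Implicit Types (g h : G) (x y w : 'rV[R]_r) (gamma : R -> G).

Local Notation c := (chart_at (1%g : G)).
Local Notation phi := (cmap c).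
Local Notation psi := (cinv c).
Local Notation o := (phi (1%g : G)).

(** The local group law; it represents the product faithfully only while both factors and their
    product lie in the chart. *)
Definition chart_mul (xy : 'rV[R]_r * 'rV[R]_r) : 'rV[R]_r :=
  phi (psi xy.1 * psi xy.2)%g.
Local Notation mu := chart_mul.

Lemma cinv_chart1 : psi o = 1%g.
Proof. by rewrite cmapK//; exact: chart_at_dom. Qed.

Lemma ccod_chart1 : ccod c o.
Proof. by exists 1%g => //; exact: chart_at_dom. Qed.

Lemma near_chart1 : \forall x \near o, cdom c (psi x) /\ phi (psi x) = x.
Proof.
have : open_nbhs o (ccod c) by split; [exact: ccod_open|exact: ccod_chart1].
move=> /open_nbhs_nbhs; apply: filterS => x [g gc <-].
by rewrite cmapK.
Qed.

Lemma near_cdom (T : topologicalType) (f : T -> G) t :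
  {for t, continuous f} -> cdom c (f t) -> \forall s \near t, cdom c (f s).
Proof.
move=> ft ct; apply: (ft (cdom c)); apply: open_nbhs_nbhs.
by split => //; exact: cdom_open.
Qed.

Lemma mulg_continuous (T : topologicalType) (f g : T -> G) t :
  {for t, continuous f} -> {for t, continuous g} ->
  {for t, continuous (fun s => (f s * g s)%g)}.
Proof.
move=> ft gt; apply: (@continuous_comp _ _ _ (fun s => (f s, g s))
  (fun xy : G * G => (xy.1 * xy.2)%g)); last exact: lie_mul_continuous.
exact: cvg_pair.
Qed.

Lemma chart_mul_cmap g h :
  cdom c g -> cdom c h -> mu (phi g, phi h) = phi (g * h)%g.
Proof. by move=> gc hc; rewrite /mu/= !cmapK. Qed.

Lemma chart_mul_diffclass k : diffclass k
  [set xy : 'rV[R]_r * 'rV[R]_r | [/\ ccod c xy.1, ccod c xy.2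
                            & cdom c (psi xy.1 * psi xy.2)%g]] mu.
Proof. by apply: lie_mul_smooth; exact: chart_at_atlas. Qed.

Lemma chart_mul_dom g h : cdom c g -> cdom c h -> cdom c (g * h)%g ->
  [set xy : 'rV[R]_r * 'rV[R]_r | [/\ ccod c xy.1, ccod c xy.2
               & cdom c (psi xy.1 * psi xy.2)%g]] (phi g, phi h).
Proof.
move=> gc hc ghc; split => /=; [by exists g|by exists h|by rewrite !cmapK].
Qed.

Lemma chart_mul_differentiable g h : cdom c g -> cdom c h -> cdom c (g * h)%g ->
  differentiable mu (phi g, phi h).
Proof.
by move=> gc hc ghc; have [+ _] := chart_mul_diffclass 1; apply;
   exact: chart_mul_dom.
Qed.

(** [Ad] already contains a first derivative of the multiplication, so differentiating [Ad] along a
    curve takes the second order of smoothness. *)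
Lemma derive_chart_mul_differentiable (w : 'rV[R]_r * 'rV[R]_r) g h :
  cdom c g -> cdom c h -> cdom c (g * h)%g ->
  differentiable (fun xy => 'D_w mu xy) (phi g, phi h).
Proof.
move=> gc hc ghc; have [_ /(_ w) [+ _]] := chart_mul_diffclass 2.
by apply; exact: chart_mul_dom.
Qed.

(** Multiplication by the identity on either side is the identity map near [o], so both partial
    derivatives are the identity. *)
Lemma derive_chart_mul1 w1 w2 : 'D_(w1, w2) mu (o, o) = w1 + w2.
Proof.
have c1 : cdom c (1%g : G) by exact: chart_at_dom.
rewrite derive_pair_split; last first.
  by apply: chart_mul_differentiable; rewrite ?mulg1.
rewrite derive_paraml derive_paramr.
rewrite (@near_eq_derive _ _ _ _ id); last first.
  near do rewrite /mu/= cinv_chart1 mulg1.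
  by apply: filterS near_chart1 => x [].
rewrite (@near_eq_derive _ _ _ _ id _ w2); last first.
  near do rewrite /mu/= cinv_chart1 mul1g.
  by apply: filterS near_chart1 => x [].
by rewrite !derive_id.
Unshelve. all: by end_near. Qed.

(** * One-parameter subgroups *)

Section OneParameterSubgroup.
Context (gamma : R -> G) (gammaP : one_parameter_subgroup gamma).

Lemma ops0 : gamma 0 = 1%g.
Proof.
apply: (mulgI (gamma 0)); rewrite mulg1 -{3}[0]addr0; apply/esym.
by case: gammaP => _ ->.
Qed.

Lemma opsD s t : gamma (s + t) = (gamma s * gamma t)%g.
Proof. by case: gammaP. Qed.

Lemma opsN t : gamma (- t) = (gamma t)^-1%g.
Proof. by apply: (mulgI (gamma t)); rewrite -opsD subrr ops0 mulgV. Qed.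

Lemma ops_continuous : continuous gamma.
Proof. by case: gammaP => -[]. Qed.

Lemma near_ops : \forall t \near (0 : R), cdom c (gamma t).
Proof.
apply: near_cdom; first exact: ops_continuous.
by rewrite ops0; exact: chart_at_dom.
Qed.

Lemma near_opsN : \forall t \near (0 : R), cdom c (gamma (- t)).
Proof.
apply: (@near_cdom _ (fun t : R => gamma (- t))).
  by apply: continuous_comp; [exact: opp_continuous|exact: ops_continuous].
by rewrite oppr0 ops0; exact: chart_at_dom.
Qed.

Lemma ops_is_derive : is_derive (0 : R) 1 (phi \o gamma) (velocity gamma 0).
Proof.
have [d _] := gammaP.1.2 c (chart_at_atlas _) 1%N.
(* [velocity] reads the curve in the chart at [gamma 0], which is the chart at the identity. *)
rewrite /velocity {1}ops0 derive1E; apply: derivableP; apply/derivable1_diffP.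
by apply: d => /=; rewrite ops0; exact: chart_at_dom.
Qed.

Lemma ops_is_deriveN :
  is_derive (0 : R) 1 (fun t => phi (gamma (- t))) (- velocity gamma 0).
Proof. exact: is_derive_opp_arg ops_is_derive. Qed.

(** Together with [velocity_scale], this lets the value at time [1] of a rescaled subgroup stand for
    the value of [gamma] at any time. *)
Lemma ops_scale a : one_parameter_subgroup (fun t => gamma (a * t)).
Proof.
split=> [|s t]; last by rewrite mulrDr opsD.
split=> [t|d da k].
  apply: (@continuous_comp _ _ _ ( *%R a) gamma); first exact: mulrl_continuous.
  exact: ops_continuous.
exact: diffclass_scale (gammaP.1.2 d da k).
Qed.

Lemma velocity_scale a :
  velocity (fun t => gamma (a * t)) 0 = a *: velocity gamma 0.
Proof.
have [_ <-] := is_derive_scale_arg a ops_is_derive.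
by rewrite {1}/velocity mulr0 ops0 derive1E.
Qed.

End OneParameterSubgroup.

(** * Uniqueness of one-parameter subgroups, and the exponential *)

Lemma near_is_derive_ops_quotient gamma1 gamma2 :
  one_parameter_subgroup gamma1 -> one_parameter_subgroup gamma2 ->
  velocity gamma1 0 = velocity gamma2 0 ->
  \forall t \near (0 : R),
    is_derive (t : R) 1 (fun s => phi (gamma1 s * gamma2 (- s))%g) 0.
Proof.
move=> op1 op2 v12; have c1 : cdom c (1%g : G) by exact: chart_at_dom.
have cN : continuous (fun s : R => gamma2 (- s)).
  move=> s; apply: (@continuous_comp _ _ _ -%R gamma2).
    exact: opp_continuous.
  exact: ops_continuous.
have cq : continuous (fun s : R => (gamma1 s * gamma2 (- s))%g).
  by move=> s; apply: mulg_continuous; [exact: ops_continuous|exact: cN].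
have nearq : \forall s \near (0 : R), cdom c (gamma1 s * gamma2 (- s))%g.
  apply: near_cdom; first exact: cq.
  by rewrite oppr0 !ops0// mulg1.
(* By [derive_chart_mul1] the derivative at [0] is the difference of the two initial velocities. *)
have dq0 : is_derive (0 : R) 1 (fun s => phi (gamma1 s * gamma2 (- s))%g) 0.
  have := is_derive_comp_curve
    (is_derive_pair (ops_is_derive op1) (ops_is_deriveN op2)).
  move=> /(_ _ mu) /=; rewrite oppr0 !ops0// derive_chart_mul1 v12 subrr.
  move=> /(_ (chart_mul_differentiable _ _ _)); rewrite mulg1 => /(_ c1 c1 c1).
  apply: near_eq_is_derive; near=> s; rewrite /= chart_mul_cmap//; near: s.
    exact: near_ops.
  exact: near_opsN.
near=> t.
have t1 : cdom c (gamma1 t) by near: t; exact: near_ops.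
have t2 : cdom c (gamma2 (- t)) by near: t; exact: near_opsN.
have tq : cdom c (gamma1 t * gamma2 (- t))%g by near: t.
apply: is_derive_translate.
(* In the chart, [f] multiplies by [gamma1 t] on the left and [gamma2 (- t)] on the right; it
   carries the quotient at time [s] to the quotient at time [s + t]. *)
pose f := fun x => mu (mu (phi (gamma1 t), x), phi (gamma2 (- t))).
have df : differentiable f (phi (gamma1 0 * gamma2 (- 0))%g).
  rewrite oppr0 !ops0// mulg1.
  apply: (@differentiable_comp _ _ _ _ (fun x => mu (phi (gamma1 t), x))
    (fun y => mu (y, phi (gamma2 (- t))))).
    apply: differentiable_paramr; apply: chart_mul_differentiable => //.
    by rewrite mulg1.
  apply: differentiable_paraml; rewrite chart_mul_cmap ?mulg1//.
  exact: chart_mul_differentiable.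
have neartq : \forall s \near (0 : R),
    cdom c (gamma1 t * (gamma1 s * gamma2 (- s)))%g.
  apply: near_cdom; last by rewrite oppr0 !ops0// !mulg1.
  by apply: mulg_continuous; [exact: cst_continuous|exact: cq].
have := is_derive_comp_curve dq0 df; rewrite derive0.
apply: near_eq_is_derive; near=> s.
have sq : cdom c (gamma1 s * gamma2 (- s))%g by near: s.
have stq : cdom c (gamma1 t * (gamma1 s * gamma2 (- s)))%g.
  by near: s.
rewrite /f /= (chart_mul_cmap t1 sq) (chart_mul_cmap stq t2); congr phi.
by rewrite addrC opprD (addrC (- t)) !opsD// !mulgA.
Unshelve. all: by end_near. Qed.

(** The quotient is constant near [0], so the curves agree there; the homomorphism property carries
    this to [t] through a small fraction [t / n]. *)
Lemma ops_unique gamma1 gamma2 :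
  one_parameter_subgroup gamma1 -> one_parameter_subgroup gamma2 ->
  velocity gamma1 0 = velocity gamma2 0 -> gamma1 = gamma2.
Proof.
move=> op1 op2 v12; apply/funext => t.
have near12 : \forall s \near (0 : R), gamma1 s = gamma2 s.
  have nearq : \forall s \near (0 : R), cdom c (gamma1 s * gamma2 (- s))%g.
    apply: near_cdom; last by rewrite oppr0 !ops0// mulg1; exact: chart_at_dom.
    apply: mulg_continuous; first exact: ops_continuous.
    apply: (@continuous_comp _ _ _ -%R gamma2); first exact: opp_continuous.
    exact: ops_continuous.
  have dq := near_is_derive_ops_quotient op1 op2 v12.
  (* The mean value argument concerns real functions, so it is applied to each coordinate. *)
  have cstq j : \forall s \near (0 : R),
      phi (gamma1 s * gamma2 (- s))%g 0 j = o 0 j.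
    have := @near0_derive0_cst R (fun s => phi (gamma1 s * gamma2 (- s))%g 0 j).
    rewrite oppr0 !ops0// mulg1; apply; apply: filterS dq => s.
    by move=> /is_derive_mxP/(_ 0 j); rewrite mxE.
  have {}cstq := filter_forall _ cstq.
  near=> s.
  have : phi (gamma1 s * gamma2 (- s))%g = o.
    by apply/rowP => j; move: j; near: s; exact: cstq.
  move=> /(congr1 psi); rewrite cinv_chart1 cmapK; last by near: s.
  rewrite opsN// => /(congr1 (fun g => g * gamma2 s)%g).
  by rewrite mulgVK mul1g.
have near2 n : \forall s \near (0 : R), gamma1 (n%:R * s) = gamma2 (n%:R * s).
  elim: n => [|n IHn]; first by near=> s; rewrite mul0r !ops0.
  near=> s; rewrite -natr1 mulrDl mul1r !opsD//.
  by congr (_ * _)%g; near: s.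
move/nbhs_ballP: near12 => [e /= e0 e12].
(* The bound exceeds [|t| / e], which puts [t / n] in the ball; the successor makes [n] nonzero. *)
pose n := (Num.bound (`|t| / e)).+1.
have n0 : n%:R != 0 :> R by rewrite pnatr_eq0.
have tE : t = n%:R * (t / n%:R) by rewrite mulrCA mulfV// mulr1.
have tn : ball 0 e (t / n%:R).
  rewrite -ball_normE/= sub0r normrN normrM normfV (ger0_norm (ler0n _ _)).
  rewrite ltr_pdivrMr ?ltr0n// mulrC -ltr_pdivrMr//.
  have := archi_boundP (divr_ge0 (normr_ge0 t) (ltW e0)).
  by move=> /lt_trans; apply; rewrite ltr_nat.
(* Only agreement at the single point [s] is kept for the induction on its multiples. *)
rewrite tE; elim: n {n0 tE tn} (t / n%:R) (e12 _ tn) => [|n IHn] s s12.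
  by rewrite mul0r !ops0.
by rewrite -natr1 mulrDl mul1r !opsD// s12 IHn.
Unshelve. all: by end_near. Qed.

Lemma ops_cst : one_parameter_subgroup (fun=> (1%g : G)).
Proof.
split=> [|s t]; last by rewrite mulg1.
by split=> [t|d _ k]; [exact: cst_continuous|exact: diffclass_cst].
Qed.

(* The constant curve covers a vector v without a one-parameter subgroup of
   velocity v, for which every lie_exp (t *: v) has the default value 1. *)
Lemma lie_exp_ops v : exists gamma : R -> G,
  one_parameter_subgroup gamma /\ forall t, lie_exp (t *: v) = gamma t.
Proof.
(* The curve chosen by [xget] may differ from [gamma] a priori; uniqueness identifies them. *)
have expE (gamma : R -> G) : one_parameter_subgroup gamma ->
    lie_exp (velocity gamma 0) = gamma 1.
  move=> op; rewrite /lie_exp; case: xgetP => [g _ [gamma' [op' v' <-]]|].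
    by rewrite (ops_unique op' op v').
  by move=> /(_ (gamma 1)) []; exists gamma.
have [[gamma [op vE]]|nex] := pselect (exists gamma : R -> G,
    one_parameter_subgroup gamma /\ velocity gamma 0 = v).
  exists gamma; split=> // t.
  by rewrite -vE -velocity_scale// expE ?mulr1//; exact: ops_scale.
exists (fun=> 1%g); split=> [|t]; first exact: ops_cst.
rewrite /lie_exp; case: xgetP => // g _ [gamma [op vE <-]].
(* At [t = 0] the constant curve is the subgroup of velocity zero. For other [t], rescaling by the
   inverse of [t] would produce a subgroup of velocity [v], a contradiction. *)
have [t0|t0] := eqVneq t 0.
  rewrite (@ops_unique gamma (fun=> 1%g))//; first exact: ops_cst.
  by rewrite vE t0 scale0r /velocity derive1_cst.
exfalso; apply: nex; exists (fun s => gamma (t^-1 * s)).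
by split; [exact: ops_scale|rewrite velocity_scale// vE scalerK].
Qed.

(** * The adjoint representation along a one-parameter subgroup *)

(** Chain rule for conjugation as a left followed by a right translation. Expanding the intermediate
    vector in the standard basis leaves only derivatives of [mu] in directions independent of
    [t]. *)
Lemma near_Ad_ops gamma w : one_parameter_subgroup gamma ->
  \forall t \near (0 : R), Ad (gamma t) w =
    \sum_i 'D_(0, w) mu (phi (gamma t), o) 0 i *:
           'D_(delta_mx 0 i, 0) mu (phi (gamma t), phi (gamma (- t))).
Proof.
move=> op; have c1 : cdom c (1%g : G) by exact: chart_at_dom.
near=> t.
have t1 : cdom c (gamma t) by near: t; exact: near_ops.
have t2 : cdom c (gamma (- t)) by near: t; exact: near_opsN.
have ttN : (gamma t * gamma (- t) = 1)%g by rewrite -opsD// subrr ops0.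
pose f1 x := mu (phi (gamma t), x).
pose f2 y := mu (y, phi (gamma (- t))).
have f1o : f1 o = phi (gamma t) by rewrite /f1 (chart_mul_cmap t1 c1) mulg1.
have df1 : differentiable f1 o.
  apply: differentiable_paramr; apply: chart_mul_differentiable => //.
  by rewrite mulg1.
have dmu2 : differentiable mu (phi (gamma t), phi (gamma (- t))).
  by apply: chart_mul_differentiable; rewrite ?ttN.
have df2 : differentiable f2 (f1 o).
  by rewrite f1o; exact: differentiable_paraml.
(* Conjugation fixes the identity, so source and target use the same chart. *)
rewrite /Ad /tangent_map !mulg1 mulgV.
have neartx : \forall x \near o, cdom c (gamma t * psi x)%g.
  apply: near_cdom; last by rewrite cinv_chart1 mulg1.
  apply: mulg_continuous; first exact: cst_continuous.
  by apply: cinv_continuous; exact: ccod_chart1.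
transitivity ('D_w (f2 \o f1) o).
  apply: near_eq_derive; near=> x.
  have xc : cdom c (psi x) /\ phi (psi x) = x by near: x; exact: near_chart1.
  have tx : cdom c (gamma t * psi x)%g.
    by near: x.
  rewrite /f1 /f2 /= -{2}xc.2 (chart_mul_cmap t1 xc.1) (chart_mul_cmap tx t2).
  by rewrite opsN.
rewrite (derive_comp w df1 df2) (derive_row _ df2) f1o derive_paramr.
by apply: eq_bigr => i _; rewrite derive_paraml.
Unshelve. all: by end_near. Qed.

Lemma derivable_derive_chart_mul (w : 'rV[R]_r * 'rV[R]_r) (f g : R -> G) i :
  f 0 = 1%g -> g 0 = 1%g ->
  derivable (phi \o f) 0 1 -> derivable (phi \o g) 0 1 ->
  derivable (fun t : R => 'D_w mu (phi (f t), phi (g t)) 0 i) 0 1.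
Proof.
move=> f0 g0 /derivable1_diffP df /derivable1_diffP dg.
move: i; suff /derivable_mxP d : derivable
    (fun t : R => 'D_w mu (phi (f t), phi (g t))) 0 1 by move=> i; exact: d.
apply/derivable1_diffP.
apply: (@differentiable_comp _ _ _ _ (fun t : R => (phi (f t), phi (g t)))
  (fun xy => 'D_w mu xy)); first exact: differentiable_pair.
have c1 : cdom c (1%g : G) by exact: chart_at_dom.
by rewrite f0 g0; apply: derive_chart_mul_differentiable; rewrite ?mulg1.
Qed.

Lemma derivable_Ad_ops gamma w : one_parameter_subgroup gamma ->
  derivable (fun t : R => Ad (gamma t) w) 0 1.
Proof.
move=> op; have c1 : cdom c (1%g : G) by exact: chart_at_dom.
apply: (@near_eq_derivable _ _ _ (fun t : R =>
    \sum_i 'D_(0, w) mu (phi (gamma t), o) 0 i *: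
           'D_(delta_mx 0 i, 0) mu (phi (gamma t), phi (gamma (- t))))).
  by apply: filterS (near_Ad_ops w op) => t ->.
have [dp _] := ops_is_derive op.
have [dN _] := ops_is_deriveN op.
apply/derivable_mxP => k j.
rewrite (_ : (fun t => _) = \sum_i
    ((fun t : R => 'D_(0, w) mu (phi (gamma t), o) 0 i) *
     (fun t : R => 'D_(delta_mx 0 i, 0) mu
                     (phi (gamma t), phi (gamma (- t))) k j))); last first.
  apply/funext => t; rewrite fct_sumE summxE.
  by apply: eq_bigr => i _; rewrite mxE.
apply: derivable_sum => i; apply: derivableM.
  (* The second argument of [mu] stays at [o], hence the constant curve. *)
  exact: (@derivable_derive_chart_mul (0, w) gamma (fun=> 1%g) i (ops0 op)
    erefl dp (derivable_cst _ _ _)).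
have N0 : gamma (- 0) = 1%g by rewrite oppr0 ops0.
rewrite (ord1 k).
exact: (@derivable_derive_chart_mul (delta_mx 0 i, 0) gamma
  (fun t => gamma (- t)) j (ops0 op) N0 dp dN).
Qed.

Lemma Ad1 w : Ad (1%g : G) w = w.
Proof.
rewrite /Ad /tangent_map !mulg1 mulgV -[RHS](derive_id o).
apply: near_eq_derive; apply: filterS near_chart1 => x [_ xK].
by rewrite /= mul1g invg1 mulg1 xK.
Qed.

Lemma Ad_mx1 (v : r.-tuple 'rV[R]_r) :
  basis_of fullv v -> Ad_mx v (1%g : G) = 1%:M.
Proof.
move=> bv; apply/matrixP => i j; rewrite !mxE Ad1.
by rewrite coord_free ?(basis_free bv)// eq_sym.
Qed.

(** The derivative of [Ad (gamma t) v_j] at [0] is the bracket of [v_i] and [v_j] by definition; its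
    [k]-th coordinate is read off by a linear form. *)
Lemma is_derive_Ad_mx (v : r.-tuple 'rV[R]_r) gamma (i : 'I_r) :
  one_parameter_subgroup gamma ->
  (forall t, lie_exp (t *: v`_i) = gamma t) ->
  is_derive (0 : R) 1 (fun t => Ad_mx v (gamma t))
    (\matrix_(k, j) structure_constant G v i j k).
Proof.
move=> op expE; apply/is_derive_mxP => k j; rewrite mxE.
rewrite (_ : (fun t => _) =
  (fun t => coord v k (Ad (gamma t) v`_j))); last first.
  by apply/funext => t; rewrite mxE.
suff dAd : is_derive (0 : R) 1 (fun t => Ad (gamma t) v`_j)
    (bracket (G := G) v`_i v`_j) by exact: is_derive_linear_row dAd.
split; first exact: derivable_Ad_ops.
rewrite -derive1E /bracket.
suff -> : (fun t => Ad (lie_exp (t *: v`_i) : G) v`_j) =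
  (fun t => Ad (gamma t) v`_j) by [].
by apply/funext => t; rewrite expE.
Qed.

(** * Infinitesimal generators of the action *)

Section Action.
Context {p : nat} (M : set 'rV[R]_p) (act : G -> 'rV[R]_p -> 'rV[R]_p)
  (actM : smooth_left_action M act).

(** The action is smooth in the chart variable, and near [0] the curve is recovered from its chart
    expression. *)
Lemma derivable_act_ops gamma z : one_parameter_subgroup gamma -> M z ->
  derivable (fun t : R => act (gamma t) z) 0 1.
Proof.
move=> op Mz; have c1 : cdom c (1%g : G) by exact: chart_at_dom.
pose f (xz : 'rV[R]_r * 'rV[R]_p) := act (psi xz.1) xz.2.
have df : differentiable f ((phi \o gamma) 0, z).
  have [d _] := act_smooth actM (chart_at_atlas (1%g : G)) 1.
  by apply: d; split => //=; rewrite ops0//; exact: ccod_chart1.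
have [d _] := is_derive_comp_curve
  (is_derive_pair (ops_is_derive op) (is_derive_cst z _ _)) df.
apply: near_eq_derivable d; near=> t.
by rewrite /f /= cmapK//; near: t; exact: near_ops.
Unshelve. all: by end_near. Qed.

Lemma is_derive_act_ops (v : r.-tuple 'rV[R]_r) gamma (i : 'I_r) z :
  one_parameter_subgroup gamma ->
  (forall t, lie_exp (t *: v`_i) = gamma t) -> M z ->
  is_derive (0 : R) 1 (fun t => act (gamma t) z)
    (\row_l infinitesimals v act z l i).
Proof.
move=> op expE Mz; have d := derivable_act_ops op Mz.
split=> //; rewrite derive_mx//; apply/rowP => l; rewrite !mxE derive1E.
suff -> : (fun t => act (lie_exp (t *: v`_i)) z 0 l) =
  (fun t => act (gamma t) z 0 l) by [].
by apply/funext => t; rewrite expE.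
Qed.

End Action.
End LieGroup.

(** * Vanishing of the momentum component of the Hamiltonian field *)

(** The gradients become derivatives of [H] on the product space, ready to be matched with the chain
    rule. *)
Lemma dsubmx_hamiltonian_field (R : realType) (r p : nat) (G : lieGroupType R r)
    (act : G -> 'rV[R]_p -> 'rV[R]_p) (v : r.-tuple 'rV[R]_r)
    (H : 'rV[R]_p * 'rV[R]_r -> R) z xi i :
  dsubmx (hamiltonian_field v act H z xi) i 0 =
  - \sum_l infinitesimals v act z l i * 'D_(delta_mx 0 l, 0) H (z, xi) +
  \sum_j Lambda G v xi i j * 'D_(0, delta_mx 0 j) H (z, xi).
Proof.
rewrite /hamiltonian_field mul_block_col col_mxKd mulNmx !mxE.
congr (- _ + _); apply: eq_bigr => j _; rewrite !mxE.
  by rewrite derive_paraml.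
by rewrite derive_paramr.
Qed.

Theorem proposition3p7 (R : realType) (r p : nat) (G : lieGroupType R r)
    (M : set 'rV[R]_p) (act : G -> 'rV[R]_p -> 'rV[R]_p)
    (v : r.-tuple 'rV[R]_r) (H : 'rV[R]_p * 'rV[R]_r -> R)
    (openM : open M) (actM : smooth_left_action M act)
    (basisv : basis_of fullv v)
    (smoothH : smooth_on (M `*` [set: 'rV[R]_r]) (H : _ -> R^o))
    (invH : forall (g : G) (z : 'rV[R]_p) (xi : 'rV[R]_r), M z ->
       H (act g^-1%g z, xi *m Ad_mx v g) = H (z, xi)) :
  (forall (z : 'rV[R]_p) (xi : 'rV[R]_r), M z ->
     dsubmx (hamiltonian_field v act H z xi) = 0) /\
  (forall (J : set R) (z : R -> 'rV[R]_p) (xi : R -> 'rV[R]_r), open J ->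
     hamiltonian_flow_line v act H M J z xi ->
     forall t, J t -> is_derive t 1 xi 0).
Proof.
have field0 z xi : M z -> dsubmx (hamiltonian_field v act H z xi) = 0.
  move=> Mz; apply/colP => i; rewrite dsubmx_hamiltonian_field mxE.
  have [gamma [op expE]] := lie_exp_ops (G := G) v`_i.
  (* The inverse of [gamma t] is [gamma (- t)]: this is the source of the sign in front of the
     transposed infinitesimals. *)
  have da := is_derive_opp_arg (is_derive_act_ops actM op expE Mz).
  have db : is_derive (0 : R) 1 (fun t => xi *m Ad_mx v (gamma t))
      (\row_j Lambda G v xi i j).
    have /is_derive_mxP dAd := is_derive_Ad_mx op expE.
    apply/is_derive_mxP => k j; rewrite (ord1 k) !mxE.
    have -> : \sum_l structure_constant G v i j l * xi 0 l =
        \sum_l xi 0 l *: (structure_constant G v i j l : R^o).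
      by apply: eq_bigr => l _; rewrite mulrC.
    rewrite (_ : (fun t => _) =
        \sum_l (xi 0 l \*: (fun t => Ad_mx v (gamma t) l j : R^o))); last first.
      by apply/funext => t; rewrite fct_sumE mxE.
    apply: is_derive_sum => l; have := dAd l j; rewrite mxE => dlj.
    exact: is_deriveZ.
  have HE : differentiable (H : _ -> R^o) (z, xi).
    by have [+ _] := smoothH 1; exact.
  have a0 : act (gamma (- 0)) z = z by rewrite oppr0 (ops0 op) (act_one actM).
  have b0 : xi *m Ad_mx v (gamma 0) = xi by rewrite (ops0 op) Ad_mx1// mulmx1.
  have := @is_derive_comp_curve _ _ _ (H : _ -> R^o) _ _ _
    (is_derive_pair da db).
  rewrite a0 b0 => /(_ HE)[_].
  (* Invariance makes [H] constant along this curve, so the chain-rule expression vanishes. *)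
  rewrite (_ : _ \o _ = cst (H (z, xi))); last first.
    by apply/funext => t; rewrite /= (opsN op) invH.
  rewrite derive_cst derive_pair_split// derive_paraml derive_paramr.
  rewrite (derive_row _ (differentiable_paraml HE)).
  rewrite (derive_row _ (differentiable_paramr HE)) => /esym HD.
  rewrite -[RHS]HD -sumrN; congr (_ + _); apply: eq_bigr => l _.
    by rewrite derive_paraml !mxE scaleNr.
  by rewrite derive_paramr !mxE.
split=> // J z xi _ flow t /flow [Mt] /is_derive_mxP d.
apply/is_derive_mxP => k j; rewrite (ord1 k) mxE.
(* The shifted index selects the [j]-th momentum in the stacked column. *)
have := d (rshift p j) 0.
have -> : hamiltonian_field v act H (z t) (xi t) (rshift p j) 0 = 0.
  by have /colP/(_ j) := field0 (z t) (xi t) Mt; rewrite !mxE.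
suff -> : (fun s => col_mx (z s)^T (xi s)^T (rshift p j) 0) =
  (fun s => xi s 0 j) by [].
by apply/funext => s; rewrite col_mxEd mxE.
Qed.
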